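(* A generalised partial metric space $(X,p)$ is categorically Cauchy complete (meaning that every Cauchy distributor on $(X,p)$, regarded as a $\mathcal{D}(R)$-enriched category, is representable) if and only if the finitely typed part of $(X,p)$ is sequentially Cauchy complete (meaning that every Cauchy sequence in it converges for the categorical topology) and $(X,p)$ has at least one point of type $\infty$, i.e. a point $x\in X$ with $p(x,x)=\infty$.
   Context: $\vee$ denotes the maximum in the natural order of $[0,\infty]$. Convention: for $a,c\ge b$ in $[0,\infty]$, $a-b+c$ is the usual value if $b<\infty$ (equal to $\infty$ if $a$ or $c$ is $\infty$), and equals $\infty$ if $b=\infty$. (This is composition in the quantaloid $\mathcal{D}(R)$ of diagonals in Lawvere's quantale $R=([0,\infty]^{\mathsf{op}},+,0)$.) A generalised partial metric space $(X,p)$ is a set $X$ with a function $p\colon X\times X\to[0,\infty]$ such that $p(y,x)\ge p(x,x)\vee p(y,y)$ and $p(z,y)-p(y,y)+p(y,x)\ge p(z,x)$ for all $x,y,z\in X$; this is the same as a category enriched in $\mathcal{D}(R)$, the type of $x$ being $p(x,x)$. Its finitely typed part is the subspace $\{x\in X\mid p(x,x)<\infty\}$ with the restriction of $p$. A presheaf of type $q\in[0,\infty]$ on $(X,p)$ is a function $\phi\colon X\to[0,\infty]$ with $q\vee p(y,y)\le\phi(y)\le p(y,x)-p(x,x)+\phi(x)$ for all $x,y\in X$. A covariant presheaf of type $q$ is a function $\psi\colon X\to[0,\infty]$ with $q\vee p(y,y)\le\psi(y)\le\psi(x)-p(x,x)+p(x,y)$ for all $x,y\in X$. A Cauchy distributor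 of type $q\in[0,\infty]$ is a presheaf $\phi$ of type $q$ for which there exists a covariant presheaf $\psi$ of type $q$ with $\inf_{z\in X}\big(\psi(z)-p(z,z)+\phi(z)\big)\le q$ and $p(y,x)\le\phi(y)-q+\psi(x)$ for all $x,y\in X$ ($\inf\emptyset=\infty$). It is representable if there is $x\in X$ with $q=p(x,x)$ and $\phi=p(-,x)$. In a finitely typed space (all $p(x,x)<\infty$): the categorical topology has closure operator $x\in\overline{S}$ iff $p(x,x)\ge\inf_{s\in S}\big(p(x,s)-p(s,s)+p(s,x)\big)$; a sequence $(x_n)_n$ is Cauchy if $(p(x_n,x_m))_{(n,m)}$ is a Cauchy net in $[0,\infty]$ for the (extended) metric $d_s(a,b)=|a-b|$ if $a,b<\infty$, $d_s(\infty,\infty)=0$, $d_s(a,b)=\infty$ otherwise. *)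

(* Defs.v *)
From HB Require Import structures.
From mathcomp Require Import all_boot all_order all_algebra.
From mathcomp Require Import mathcomp_extra boolp classical_sets functions.
From mathcomp Require Import reals constructive_ereal ereal topology normedtype.
From mathcomp Require Import sequences lra.

Set Implicit Arguments.
Unset Strict Implicit.
Unset Printing Implicit Defensive.

Import Order.TTheory GRing.Theory Num.Theory.

Local Open Scope classical_set_scope.
Local Open Scope ring_scope.
Local Open Scope ereal_scope.

(* The interval [0, +oo] is represented by the nonnegative elements of
   \bar R.  [dcomp a b c] is "a - b + c" and is only used for
   0 <= b <= a, c; it is then nonnegative, and for b < +oo the library's
   conventions on +oo give +oo as soon as a or c is +oo. *)
Definition dcomp (R : realType) (a b c : \bar R) : \bar R :=
  if b == +oo then +oo else a - b + c.

Record gpmSpace (R : realType) := GPMSpace {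
  gpm_point :> Type;
  gpm_dist : gpm_point -> gpm_point -> \bar R;
  gpm_dist_ge0 : forall x y, 0 <= gpm_dist x y;
  gpm_dist_self : forall x y,
    Order.max (gpm_dist x x) (gpm_dist y y) <= gpm_dist y x;
  gpm_dist_triangle : forall x y z,
    gpm_dist z x <= dcomp (gpm_dist z y) (gpm_dist y y) (gpm_dist y x) }.

Record finGpmSpace (R : realType) := FinGPMSpace {
  fin_gpm :> gpmSpace R;
  fin_gpm_type : forall x : fin_gpm, gpm_dist x x < +oo }.

Section FinitePart.
Variables (R : realType) (X : gpmSpace R).

Definition finite_point := {x : X | gpm_dist x x < +oo}.

Definition finite_dist (x y : finite_point) := gpm_dist (sval x) (sval y).

Lemma finite_dist_ge0 x y : 0 <= finite_dist x y.
Proof. exact: gpm_dist_ge0. Qed.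

Lemma finite_dist_self x y :
  Order.max (finite_dist x x) (finite_dist y y) <= finite_dist y x.
Proof. exact: gpm_dist_self. Qed.

Lemma finite_dist_triangle x y z : finite_dist z x <=
  dcomp (finite_dist z y) (finite_dist y y) (finite_dist y x).
Proof. exact: gpm_dist_triangle. Qed.

Definition finite_part_gpm : gpmSpace R :=
  GPMSpace finite_dist_ge0 finite_dist_self finite_dist_triangle.

Lemma finite_part_type (x : finite_part_gpm) : gpm_dist x x < +oo.
Proof. exact: svalP x. Qed.

Definition finite_part : finGpmSpace R := FinGPMSpace finite_part_type.

End FinitePart.

Section Distributors.
Variables (R : realType) (X : gpmSpace R).
Local Notation p := (@gpm_dist R X).
Implicit Types (q : \bar R) (phi psi : X -> \bar R).

(* For 0 <= q, the lower bound forces the values to lie in [0, +oo]. *)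
Definition is_presheaf q phi := forall x y,
  Order.max q (p y y) <= phi y /\
  phi y <= dcomp (p y x) (p x x) (phi x).

Definition is_copresheaf q psi := forall x y,
  Order.max q (p y y) <= psi y /\
  psi y <= dcomp (psi x) (p x x) (p x y).

Definition is_cauchy_distributor q phi :=
  is_presheaf q phi /\
  exists psi, [/\ is_copresheaf q psi,
    ereal_inf [set dcomp (psi z) (p z z) (phi z) | z in [set: X]] <= q &
    forall x y, p y x <= dcomp (phi y) q (psi x)].

Definition is_representable q phi :=
  exists x, q = p x x /\ phi = fun y => p y x.

Definition categorically_cauchy_complete := forall q phi, 0 <= q ->
  is_cauchy_distributor q phi -> is_representable q phi.

End Distributors.

Definition cat_closure (R : realType) (X : finGpmSpace R) (S : set X) : set X :=
  [set x | ereal_inf [set dcomp (gpm_dist x s) (gpm_dist s s) (gpm_dist s x)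
                     | s in S] <= gpm_dist x x].

Section CatClosureTheory.
Variables (R : realType) (X : finGpmSpace R).
Local Notation p := (@gpm_dist R X).
Implicit Types (S T : set X) (x y z : X).

Let loop x s := dcomp (p x s) (p s s) (p s x).

Let pxxE x : exists2 r : R, p x x = r%:E & (0 <= r)%R.
Proof.
have := fin_gpm_type x; have := gpm_dist_ge0 x x.
by case: (p x x) => [r| |] //; rewrite lee_fin; exists r.
Qed.

Lemma cat_closureP S x : cat_closure S x <->
  forall e : R, (0 < e)%R -> exists2 s, S s & loop x s < p x x + e%:E.
Proof.
have [r rE r0] := pxxE x; split => [Sx e e0|Sx].
  have /ereal_inf_lt[_ [s Ss <-] lt] :
      ereal_inf [set loop x s | s in S] < p x x + e%:E.
    by apply: le_lt_trans Sx _; rewrite rE -EFinD lte_fin; lra.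
  by exists s.
apply/lee_addgt0Pr => e /Sx[s Ss /ltW]; apply: le_trans.
by apply: ereal_inf_lbound; exists s.
Qed.

Lemma cat_closure_ext S : S `<=` cat_closure S.
Proof.
move=> x Sx; apply/cat_closureP => e e0; exists x => //.
rewrite /loop /dcomp; have [r -> _] := pxxE x.
by rewrite /= -!EFinD lte_fin; lra.
Qed.

Lemma cat_closureS S T : S `<=` T -> cat_closure S `<=` cat_closure T.
Proof.
move=> ST x /cat_closureP Sx; apply/cat_closureP => e /Sx[s Ss lt].
by exists s => //; exact: ST.
Qed.

Lemma cat_closure0 : cat_closure (set0 : set X) = set0.
Proof. by apply/seteqP; split => // x /cat_closureP /(_ 1%R ltr01)[]. Qed.

Lemma cat_closureU S T :
  cat_closure (S `|` T) = cat_closure S `|` cat_closure T.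
Proof.
apply/seteqP; split; last first.
  by move=> x []; apply: cat_closureS => y; [left|right].
move=> x /cat_closureP STx; apply: contrapT => /not_orP[].
move=> /cat_closureP/existsNP[e1 /not_implyP[e10 nS]].
move=> /cat_closureP/existsNP[e2 /not_implyP[e20 nT]].
have [r rE _] := pxxE x.
have e0 : (0 < Num.min e1 e2)%R by rewrite lt_min e10.
have [s [Ss|Ts] lt] := STx _ e0.
- apply: nS; exists s => //; apply: lt_le_trans lt _.
  by rewrite rE -!EFinD lee_fin lerD2l ge_min lexx.
- apply: nT; exists s => //; apply: lt_le_trans lt _.
  by rewrite rE -!EFinD lee_fin lerD2l ge_min lexx orbT.
Qed.

Lemma cat_closureK S : cat_closure (cat_closure S) = cat_closure S.
Proof.
apply/seteqP; split; last exact: cat_closure_ext.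
move=> x /cat_closureP Sx; apply/cat_closureP => e e0.
have e20 : (0 < e / 2)%R by lra.
have [y /cat_closureP /(_ _ e20)[s Ss ys] xy] := Sx _ e20.
exists s => //; move: xy ys; rewrite /loop.
have := gpm_dist_triangle s y x; have := gpm_dist_triangle x y s.
have := gpm_dist_ge0 x y; have := gpm_dist_ge0 y x.
have := gpm_dist_ge0 y s; have := gpm_dist_ge0 s y.
have := gpm_dist_ge0 x s; have := gpm_dist_ge0 s x.
have [a -> _] := pxxE x; have [b -> _] := pxxE y; have [c -> _] := pxxE s.
rewrite /dcomp /=.
case: (p x y) => [xy| |] //; case: (p y x) => [yx| |] //;
case: (p y s) => [ys| |] //; case: (p s y) => [sy| |] //;
case: (p x s) => [xs| |] //; case: (p s x) => [sx| |] //.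
rewrite /= -!EFinD ?lee_fin ?lte_fin; lra.
Qed.

End CatClosureTheory.

(* The points of X, equipped with the topology whose closed sets are the
   fixed points of [cat_closure]. *)
Definition cat_space (R : realType) (X : finGpmSpace R) : Type := X.

HB.instance Definition _ (R : realType) (X : finGpmSpace R) :=
  gen_eqMixin (cat_space X).
HB.instance Definition _ (R : realType) (X : finGpmSpace R) :=
  gen_choiceMixin (cat_space X).

Section CatTopology.
Variables (R : realType) (X : finGpmSpace R).

Definition cat_open (U : set (cat_space X)) :=
  cat_closure (~` U : set X) = ~` U.

Let cat_openT : cat_open setT.
Proof. by rewrite /cat_open setCT cat_closure0. Qed.

Let cat_openI : setI_closed cat_open.
Proof. by move=> U V oU oV; rewrite /cat_open setCI cat_closureU oU oV. Qed.

Let cat_open_bigU (I : Type) (f : I -> set (cat_space X)) :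
  (forall i, cat_open (f i)) -> cat_open (\bigcup_i f i).
Proof.
move=> of_; apply/seteqP; split; last exact: cat_closure_ext.
move=> x Sx [i _ fix_]; have : (~` f i) x; last exact.
by rewrite -(of_ i); apply: cat_closureS Sx => y nfy fiy; apply: nfy; exists i.
Qed.

HB.instance Definition _ :=
  isOpenTopological.Build (cat_space X) cat_openT cat_openI cat_open_bigU.

Lemma cat_openE : open = cat_open. Proof. by []. Qed.

Lemma closure_cat_space (S : set (cat_space X)) :
  closure S = cat_closure (S : set X).
Proof.
apply/seteqP; split.
- rewrite closureE; apply: smallest_sub; last exact: cat_closure_ext.
  by rewrite -openC cat_openE /cat_open setCK cat_closureK.
- have : closed (closure S) by exact: closed_closure.
  rewrite -openC cat_openE /cat_open setCK => cS x Sx.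
  by rewrite -cS; apply: cat_closureS Sx; exact: (@topology_structure.subset_closure (cat_space X) S).
Qed.

End CatTopology.

Definition ext_dist (R : realType) (a b : \bar R) : \bar R :=
  match a, b with
  | a'%:E, b'%:E => `|a' - b'|%:E
  | +oo, +oo => 0
  | _, _ => +oo
  end.

Definition cauchy_net (R : realType) (I : Type) (le : I -> I -> Prop)
    (u : I -> \bar R) :=
  forall e : R, (0 < e)%R -> exists i0, forall i j,
    le i0 i -> le i0 j -> ext_dist (u i) (u j) < e%:E.

Definition cauchy_sequence (R : realType) (X : finGpmSpace R) (x : nat -> X) :=
  @cauchy_net R (nat * nat)%type (fun i j => (i.1 <= j.1)%N && (i.2 <= j.2)%N)
    (fun nm => gpm_dist (x nm.1) (x nm.2)).

Definition sequentially_cauchy_complete (R : realType) (X : finGpmSpace R) :=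
  forall x : nat -> X, cauchy_sequence x ->
    exists l : cat_space X, (x : nat -> cat_space X) @ \oo --> l.

(* Main.v *)
Require Import Defs.
From mathcomp Require Import all_boot all_order all_algebra.
From mathcomp Require Import reals constructive_ereal.
From mathcomp Require Import boolp classical_sets ereal topology sequences lra.
From mathcomp Require Import normedtype.

(** Write [p] for the distance.  A Cauchy distributor of type +oo is constantly
    +oo, and it is represented exactly by the points of type +oo; this accounts
    for the second condition.  The content is therefore that Cauchy distributors
    of a finite type [q] and Cauchy sequences of finitely typed points are two
    presentations of the same data.

    From a Cauchy sequence [x] to a distributor: let [q] be the limit of
    [p (x n) (x n)], and let [phi y], [psi y] be the limits of [p y (x n)] and
    [p (x n) y].  By the triangle inequality
      p y (x m) <= p y (x n) - p (x n) (x n) + p (x n) (x m),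
    where the last two terms nearly cancel, so that the convergence is uniform
    in [y] ([limit_approx]).  Passing to the limit in the axioms of a partial
    metric makes [phi] a Cauchy distributor with adjoint [psi]
    ([limit_cauchy_distributor]), and any point that represents [phi] is a limit
    of [x] ([cvg_of_limit_representable]).

    From a distributor [phi] with adjoint [psi] to a sequence: points [z] where
    psi z - p z z + phi z is close to its infimum [q] have [phi z], [psi z] and
    [p z z] all close to [q] ([dcomp_squeeze]), and the inequality
    p y x <= phi y - q + psi x shows that a sequence of such points, ever closer,
    is Cauchy ([cauchy_sequence_of_distributor]).  A point [l] is a limit of that
    sequence when p l z - p z z + p z l tends to [p l l]; by the same squeezing,
    [p l z] and [p z l] tend to [p l l], which forces [q = p l l] and
    [phi = p(-, l)] ([cauchy_distributor_represented]).

    All limits are handled through inequalities up to an additive real error,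
    which avoids having to separate finite from infinite distances. *)

Set Implicit Arguments.
Unset Strict Implicit.
Unset Printing Implicit Defensive.

Import Order.TTheory GRing.Theory Num.Theory.

Local Open Scope classical_set_scope.
Local Open Scope ring_scope.
Local Open Scope ereal_scope.

(** * Estimates for the composition a - b + c *)

Section Dcomp.
Variable R : realType.
Implicit Types (a b c : \bar R) (r e : R).

Lemma dcomp_le_addl a c r e :
  0 <= a -> c <= (r + e)%:E -> dcomp a r%:E c <= a + e%:E.
Proof.
rewrite /dcomp /=; case: a => [a| |] //; case: c => [c| |] //=;
  rewrite ?leey ?leNye //.
rewrite -?EFinD !lee_fin; lra.
Qed.

Lemma dcomp_le_addr a c r e :
  0 <= c -> a <= (r + e)%:E -> dcomp a r%:E c <= c + e%:E.
Proof.
rewrite /dcomp /=; case: a => [a| |] //; case: c => [c| |] //=;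
  rewrite ?leey ?leNye //.
rewrite -?EFinD !lee_fin; lra.
Qed.

(** Both a - b and c - b are nonnegative, so that when the composite
    a + (c - b) = c + (a - b) is hardly larger than [d], which is below [a] and
    [c], there is no room left between any of the four quantities.  Finiteness of
    the composite also forces [b] to be finite. *)
Lemma dcomp_squeeze a b c (d e : R) : 0 <= b ->
  Order.max d%:E b <= a -> Order.max d%:E b <= c ->
  dcomp a b c < (d + e)%:E ->
  exists2 r, b = r%:E & [/\ a <= (r + e)%:E, a < (d + e)%:E,
    c <= (r + e)%:E & c < (d + e)%:E].
Proof.
rewrite !ge_max /dcomp.
case: b => [b| |] //= b0; case: a => [a| |] //=; case: c => [c| |] //=.
rewrite -?EFinD !lee_fin !lte_fin => /andP[da ba] /andP[dc bc] abc.
by exists b => //; split; rewrite ?lee_fin ?lte_fin; lra.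
Qed.

Lemma le_dcomp a a' b c c' : a <= a' -> c <= c' -> dcomp a b c <= dcomp a' b c'.
Proof.
by rewrite /dcomp; case: eqP => // _ aa' cc'; exact: leeD (leeD2r _ aa') cc'.
Qed.

Lemma dcompDl a b c e : dcomp (a + e%:E) b c = dcomp a b c + e%:E.
Proof. by rewrite /dcomp; case: eqP => // _; rewrite !(addeAC _ e%:E). Qed.

Lemma dcompDr a b c e : dcomp a b (c + e%:E) = dcomp a b c + e%:E.
Proof. by rewrite /dcomp; case: eqP => // _; rewrite addeA. Qed.

Lemma dcomp_le_mid a c (q r e : R) : (q <= r + e)%R ->
  dcomp a r%:E c <= dcomp a q%:E c + e%:E.
Proof.
move=> qr; rewrite /dcomp /= [leRHS]addeAC leeD2r //.
by rewrite -addeA leeD2l // lee_fin; lra.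
Qed.

Lemma lee_addD a b c e e' : a <= b + e%:E -> b <= c + e'%:E ->
  a <= c + (e + e')%:E.
Proof.
by move=> ab bc; rewrite (le_trans ab)// (addrC e) EFinD addeA leeD2r.
Qed.

Lemma dcompyl b c : 0 <= b -> 0 <= c -> dcomp +oo b c = +oo.
Proof. by rewrite /dcomp; case: b c => [b| |] [c| |]. Qed.

Lemma dcompyr a b : 0 <= a -> 0 <= b -> dcomp a b +oo = +oo.
Proof. by rewrite /dcomp; case: a b => [a| |] [b| |]. Qed.

End Dcomp.

(** * Convergence and Cauchy sequences in terms of real errors *)

(** One-sided inequalities between all pairs of far terms are a Cauchy condition
    that also allows them to be all infinite; the bound [e] for the pairs then
    passes to the limit superior with the same [N]. *)
Lemma limn_esup_approx (R : realType) (u : nat -> \bar R) (e : R) (N : nat) :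
  (forall n m, (N <= n)%N -> (N <= m)%N -> u m <= u n + e%:E) ->
  forall n, (N <= n)%N ->
    u n <= limn_esup u + e%:E /\ limn_esup u <= u n + e%:E.
Proof.
move=> uN n Nn; split; last first.
  apply: (@le_trans _ _ (esups u N)).
    by apply: ereal_inf_lbound; exists [set m | (N <= m)%N] => //; exists N.
  by apply: ge_ereal_sup => _ [m /= Nm <-]; exact: uN.
rewrite -leeBlDr //; apply: le_ereal_inf_tmp => _ [V [M _ MV] <-].
(* a term beyond both [N] and [M] lies in [V] and is close to [u n] *)
apply: (@le_trans _ _ (u (maxn N M))).
  by rewrite leeBlDr //; apply: uN => //; exact: leq_maxl.
by apply: ereal_sup_ubound; exists (maxn N M) => //; apply: MV; exact: leq_maxr.
Qed.

(** The sets of points [s] for which the loop at [l] through [s] exceeds [p l l]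
    by less than [e] form a neighbourhood basis of [l], since [l] is outside the
    closure of a set exactly when the set misses one of them. *)
Lemma cvg_cat_spaceP (R : realType) (X : finGpmSpace R) (x : nat -> X) (l : X) :
  ((x : nat -> cat_space X) @ \oo --> (l : cat_space X)) <->
  forall e : R, (0 < e)%R -> \forall n \near \oo,
    dcomp (gpm_dist l (x n)) (gpm_dist (x n) (x n)) (gpm_dist (x n) l)
      < gpm_dist l l + e%:E.
Proof.
split=> [xl e e0|xl A].
- pose S := [set s : X | gpm_dist l l + e%:E <=
    dcomp (gpm_dist l s) (gpm_dist s s) (gpm_dist s l)].
  have : nbhs (l : cat_space X) (~` (S : set (cat_space X))).
    rewrite -[nbhs _ _]/((~` (S : set (cat_space X)))° l) interiorC.
    rewrite closure_cat_space => /cat_closureP /(_ _ e0)[s Ss].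
    by rewrite /= ltNge Ss.
  move=> Snb; have nearS : \forall n \near \oo, ~ S (x n) := xl _ Snb.
  apply: filterS nearS => n nS.
  by rewrite ltNge; apply/negP.
- rewrite -[A]setCK -[nbhs (l : cat_space X) _]/((~` ~` A)° (l : cat_space X)) interiorC.
  rewrite closure_cat_space setCK => nl.
  suff : \forall n \near \oo, A (x n) by [].
  apply: contrapT => nA; apply: nl; apply/cat_closureP => e e0.
  apply: contrapT => nS; apply: nA; near=> n.
  apply: contrapT => nAn; apply: nS; exists (x n) => //.
  by near: n; exact: xl.
Unshelve. all: by end_near. Qed.

(** The distances between far terms are finite, because they are compared with
    a self-distance; hence the extended metric can be replaced by plain
    inequalities. *)
Lemma cauchy_sequenceP (R : realType) (X : finGpmSpace R) (x : nat -> X) :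
  cauchy_sequence x <-> forall e : R, (0 < e)%R ->
    exists N, forall n m k l, (N <= n)%N -> (N <= m)%N -> (N <= k)%N ->
      (N <= l)%N -> gpm_dist (x n) (x m) <= gpm_dist (x k) (x l) + e%:E.
Proof.
split=> xC e e0.
- have [[N1 N2] /= NP] := xC _ e0.
  exists (maxn N1 N2) => n m k l; rewrite !geq_max.
  move=> /andP[n1 n2] /andP[m1 m2] /andP[k1 k2] /andP[l1 l2].
  move: (NP (n, m) (k, l)); rewrite /= n1 m2 k1 l2 => /(_ isT isT).
  case: gpm_dist => [a| |]; case: gpm_dist => [b| |] //=.
  rewrite -EFinD lte_fin lee_fin ltr_norml; lra.
- have e20 : (0 < e / 2)%R by lra.
  have [N NP] := xC _ e20; exists (N, N) => -[n m] [k l] /=.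
  move=> /andP[Nn Nm] /andP[Nk Nl].
  have fin i j : (N <= i)%N -> (N <= j)%N -> gpm_dist (x i) (x j) \is a fin_num.
    move=> Ni Nj; rewrite ge0_fin_numE ?gpm_dist_ge0 //.
    apply: le_lt_trans (NP _ _ N N Ni Nj _ _) _ => //.
    by rewrite lte_add_pinfty ?ltry // fin_gpm_type.
  move: (fin _ _ Nn Nm) (fin _ _ Nk Nl) (NP _ _ _ _ Nn Nm Nk Nl)
    (NP _ _ _ _ Nk Nl Nn Nm).
  case: (gpm_dist (x n) _) => [a| |]; case: gpm_dist => [b| |] //= _ _.
  rewrite -!EFinD lte_fin !lee_fin ltr_norml; lra.
Qed.

(** * The Cauchy distributor of a Cauchy sequence *)

Section CauchySequenceLimit.
Variables (R : realType) (X : gpmSpace R).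
Local Notation p := (@gpm_dist R X).

Lemma gpm_self_le (x y : X) : p x x <= p y x /\ p y y <= p y x.
Proof. by have := gpm_dist_self x y; rewrite ge_max => /andP. Qed.

Lemma finite_self (x : finite_part X) :
  exists2 r : R, p (sval x) (sval x) = r%:E & (0 <= r)%R.
Proof.
have := svalP x; have := gpm_dist_ge0 (sval x) (sval x).
by case: (p _ _) => [r| |] //; exists r.
Qed.

Variable x : nat -> finite_part X.
Local Notation x_ n := (sval (x n)).

(** The limit superior is taken only because it is always defined: along a Cauchy
    sequence the limits exist. *)
Definition limit_type := limn_esup (fun n => p (x_ n) (x_ n)).
Definition limit_presheaf (y : X) := limn_esup (fun n => p y (x_ n)).
Definition limit_copresheaf (y : X) := limn_esup (fun n => p (x_ n) y).

Hypothesis xC : cauchy_sequence x.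

(** The index [N] does not depend on [y].  This uniformity allows [y] to be a far
    term of the sequence itself, as in the last two bounds. *)
Lemma limit_approx (e : R) : (0 < e)%R -> exists N, forall n, (N <= n)%N ->
  exists2 r : R, p (x_ n) (x_ n) = r%:E &
  [/\ r%:E <= limit_type + e%:E /\ limit_type <= r%:E + e%:E,
    forall y, p y (x_ n) <= limit_presheaf y + e%:E /\
      limit_presheaf y <= p y (x_ n) + e%:E,
    forall y, p (x_ n) y <= limit_copresheaf y + e%:E /\
      limit_copresheaf y <= p (x_ n) y + e%:E,
    limit_presheaf (x_ n) <= r%:E + e%:E &
    limit_copresheaf (x_ n) <= r%:E + e%:E].
Proof.
move=> e0; have [N NP] := (cauchy_sequenceP x).1 xC _ e0; exists N => n Nn.
have phiP y : p y (x_ n) <= limit_presheaf y + e%:E /\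
    limit_presheaf y <= p y (x_ n) + e%:E.
  apply: limn_esup_approx Nn => i j Ni Nj.
  apply: le_trans (gpm_dist_triangle (x_ j) (x_ i) y) _.
  have [r rE _] := finite_self (x i); rewrite rE.
  by apply: dcomp_le_addl; rewrite ?gpm_dist_ge0 // EFinD -rE; exact: NP.
have psiP y : p (x_ n) y <= limit_copresheaf y + e%:E /\
    limit_copresheaf y <= p (x_ n) y + e%:E.
  apply: limn_esup_approx Nn => i j Ni Nj.
  apply: le_trans (gpm_dist_triangle y (x_ i) (x_ j)) _.
  have [r rE _] := finite_self (x i); rewrite rE.
  by apply: dcomp_le_addr; rewrite ?gpm_dist_ge0 // EFinD -rE; exact: NP.
have [r rE _] := finite_self (x n); exists r => //; rewrite -rE; split => //.
- have := @limn_esup_approx _ (fun n => p (x_ n) (x_ n)) e N; apply => //.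
  by move=> i j Ni Nj; exact: NP.
- exact: (phiP _).2.
- exact: (psiP _).2.
Qed.

Lemma limit_type_real : exists2 q : R, limit_type = q%:E & (0 <= q)%R.
Proof.
have : 0 <= limit_type.
  apply: limf_esup_ge0 => [|n]; last exact: gpm_dist_ge0.
  by move=> [N _ /(_ N (leqnn N))].
have [N /(_ N (leqnn N))[r _ [[_ +] _ _ _ _]]] := limit_approx ltr01.
by case: limit_type => [q| |] //; exists q.
Qed.

Lemma limit_presheafP : is_presheaf limit_type limit_presheaf.
Proof.
move=> z y; split.
- rewrite ge_max; apply/andP; split; apply/lee_addgt0Pr => e e0.
  + have [|N /(_ N (leqnn N))[r rE [[_ qr] phiP _ _ _]]] := @limit_approx (e / 2).
      by lra.
    rewrite [e in _ + e%:E]splitr; apply: lee_addD qr _; rewrite -rE.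
    exact: le_trans (gpm_self_le _ y).1 (phiP y).1.
  + have [N /(_ N (leqnn N))[r rE [_ phiP _ _ _]]] := limit_approx e0.
    exact: le_trans (gpm_self_le _ y).2 (phiP y).1.
- apply/lee_addgt0Pr => e e0.
  have [|N /(_ N (leqnn N))[r rE [_ phiP _ _ _]]] := @limit_approx (e / 2).
    by lra.
  rewrite [e in _ + e%:E]splitr; apply: lee_addD (phiP y).2 _.
  rewrite -dcompDr; apply: le_trans (gpm_dist_triangle _ z y) _.
  exact: le_dcomp (phiP z).1.
Qed.

Lemma limit_copresheafP : is_copresheaf limit_type limit_copresheaf.
Proof.
move=> z y; split.
- rewrite ge_max; apply/andP; split; apply/lee_addgt0Pr => e e0.
  + have [|N /(_ N (leqnn N))[r rE [[_ qr] _ psiP _ _]]] := @limit_approx (e / 2).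
      by lra.
    rewrite [e in _ + e%:E]splitr; apply: lee_addD qr _; rewrite -rE.
    exact: le_trans (gpm_self_le y _).2 (psiP y).1.
  + have [N /(_ N (leqnn N))[r rE [_ _ psiP _ _]]] := limit_approx e0.
    exact: le_trans (gpm_self_le y _).1 (psiP y).1.
- apply/lee_addgt0Pr => e e0.
  have [|N /(_ N (leqnn N))[r rE [_ _ psiP _ _]]] := @limit_approx (e / 2).
    by lra.
  rewrite [e in _ + e%:E]splitr; apply: lee_addD (psiP y).2 _.
  rewrite -dcompDl; apply: le_trans (gpm_dist_triangle y z _) _.
  exact: le_dcomp (psiP z).1 _.
Qed.

Lemma limit_cauchy_distributor : is_cauchy_distributor limit_type limit_presheaf.
Proof.
split; first exact: limit_presheafP.
exists limit_copresheaf; split; first exact: limit_copresheafP.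
- apply/lee_addgt0Pr => e e0.
  have [|N /(_ N (leqnn N))[r rE [[rq _] _ _ phir psir]]] := @limit_approx (e / 3).
    by lra.
  apply: (@le_trans _ _ (dcomp (limit_copresheaf (x_ N)) r%:E
      (limit_presheaf (x_ N)))).
    by apply: ereal_inf_lbound; exists (x_ N); rewrite ?rE.
  have psi0 : 0 <= limit_copresheaf (x_ N).
    have := (limit_copresheafP (x_ N) (x_ N)).1; rewrite ge_max => /andP[_].
    exact: le_trans (gpm_dist_ge0 _ _).
  have eE : e = (e / 3 + (e / 3 + e / 3))%R by lra.
  rewrite [e in _ + e%:E]eE; apply: lee_addD (lee_addD psir rq).
  by apply: dcomp_le_addl; rewrite // EFinD.
- move=> z y; apply/lee_addgt0Pr => e e0.
  have [|N /(_ N (leqnn N))[r rE [[_ qr] phiP psiP _ _]]] := @limit_approx (e / 3).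
    by lra.
  have [q qE _] := limit_type_real; rewrite qE -EFinD lee_fin in qr *.
  apply: le_trans (gpm_dist_triangle z (x_ N) y) _; rewrite rE.
  apply: le_trans (le_dcomp _ (phiP y).1 (psiP z).1) _.
  rewrite dcompDl dcompDr.
  apply: le_trans (leeD2r _ (leeD2r _ (dcomp_le_mid _ _ qr))) _.
  move: (dcomp _ q%:E _) => D.
  by rewrite -!addeA -!EFinD leeD2l // lee_fin; lra.
Qed.

Lemma cvg_of_limit_representable :
  is_representable limit_type limit_presheaf ->
  exists l : cat_space (finite_part X),
    (x : nat -> cat_space (finite_part X)) @ \oo --> l.
Proof.
move=> [l [qE phiE]]; have [q rq _] := limit_type_real.
have lfin : p l l < +oo by rewrite -qE rq ltry.
exists (exist _ l lfin : finite_part X); apply/cvg_cat_spaceP => e e0.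
have [|N NP] := @limit_approx (e / 3); first by lra.
exists N => // n /= /NP[r rE [_ phiP _ phir _]].
rewrite /gpm_dist /= /finite_dist /= rE.
have -> : p (x_ n) l = limit_presheaf (x_ n) by rewrite phiE.
apply: (@le_lt_trans _ _ (p l l + (e / 3 + e / 3)%:E)).
  apply: lee_addD; first by apply: dcomp_le_addl; rewrite ?gpm_dist_ge0 // EFinD.
  by have := (phiP l).1; rewrite {1}phiE.
by rewrite -qE rq -!EFinD lte_fin; lra.
Qed.

End CauchySequenceLimit.

(** * The Cauchy sequence of a Cauchy distributor *)

Section Representability.
Variables (R : realType) (X : gpmSpace R).
Local Notation p := (@gpm_dist R X).

(** It suffices that some points [z] are simultaneously close to the distributor
    and close to [l].  Comparing through such a [z] gives [q = p l l],
    phi l <= q and psi l <= q.  The presheaf inequality at [l] then yields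
    phi y <= p y l, and the adjunction inequality yields p y l <= phi y. *)
Lemma cauchy_distributor_represented (q : R) (phi psi : X -> \bar R)
    (l : finite_part X) :
  is_presheaf q%:E phi -> is_copresheaf q%:E psi ->
  (forall x y, p y x <= dcomp (phi y) q%:E (psi x)) ->
  (forall e : R, (0 < e)%R -> exists z,
    dcomp (psi z) (p z z) (phi z) < (q + e)%:E /\
    dcomp (p (sval l) z) (p z z) (p z (sval l)) <
      p (sval l) (sval l) + e%:E) ->
  q%:E = p (sval l) (sval l) /\ phi = fun y => p y (sval l).
Proof.
move=> phiP psiP unit near.
have [s sE s0] := finite_self l; move: (sval l) sE near => {}l sE near.
have approx (e : R) : (0 < e)%R -> exists (z : X) (r : R),
    [/\ p z z = r%:E, (q <= s + e)%R /\ (s <= q + e)%R,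
      phi l <= (s + e)%:E & psi l <= (q + e)%:E].
  move=> e0; have e20 : (0 < e / 2)%R by lra.
  have [z [pp ll]] := near _ e20.
  have phz := (phiP z z).1; have psz := (psiP z z).1.
  have [r rE [psr psq phr phq]] :=
    dcomp_squeeze (gpm_dist_ge0 z z) psz phz pp.
  rewrite sE -EFinD in ll.
  have lz := gpm_dist_self z l; have zl := gpm_dist_self l z.
  rewrite maxC in lz; rewrite sE in lz zl.
  (* squeezing around [z] twice: first for type [q], now for type [p l l] *)
  have [r' + [lzr lzs zlr zls]] := dcomp_squeeze (gpm_dist_ge0 z z) lz zl ll.
  rewrite rE => -[rr']; rewrite -{r'}rr' in lzr zlr.
  exists z, r; split => //.
  - move: phz phr phq lz lzs lzr; rewrite !ge_max rE.
    case: (phi z) => [a| |]; case: (p l z) => [b| |];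
      rewrite ?lee_fin ?lte_fin // => /andP[? ?] ? ? /andP[? ?] ? ?.
    by split; lra.
  - apply: le_trans (phiP z l).2 _; rewrite rE.
    apply: le_trans (dcomp_le_addl (gpm_dist_ge0 _ _) phr) _.
    apply: le_trans (leeD2r _ (ltW lzs)) _.
    by rewrite -EFinD lee_fin; lra.
  - apply: le_trans (psiP z l).2 _; rewrite rE.
    have psi0 : 0 <= psi z.
      by move: psz; rewrite ge_max => /andP[_]; exact: le_trans (gpm_dist_ge0 _ _).
    apply: le_trans (dcomp_le_addl psi0 zlr) _.
    apply: le_trans (leeD2r _ (ltW psq)) _.
    by rewrite -EFinD lee_fin; lra.
have qs : q = s.
  apply/eqP; rewrite eq_le; apply/andP; split; apply/ler_addgt0Pr => e /approx.
    by move=> [z [r [_ []]]].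
  by move=> [z [r [_ []]]].
have phil : phi l <= (s + 0)%:E.
  rewrite addr0; apply/lee_addgt0Pr => e /approx[z [r [_ _ + _]]].
  by rewrite EFinD.
have psil : psi l <= (q + 0)%:E.
  rewrite addr0; apply/lee_addgt0Pr => e /approx[z [r [_ _ _ +]]].
  by rewrite EFinD.
split; first by rewrite qs.
apply/funext => y; apply/eqP; rewrite eq_le; apply/andP; split.
- apply: le_trans (phiP l y).2 _; rewrite sE -[leRHS]adde0.
  exact: dcomp_le_addl (gpm_dist_ge0 _ _) phil.
- apply: le_trans (unit l y) _; rewrite -[leRHS]adde0.
  apply: dcomp_le_addl psil; have := (phiP y y).1; rewrite ge_max => /andP[_].
  exact: le_trans (gpm_dist_ge0 _ _).
Qed.

(** For points [x n] and [x m] of small excess over [q], the distance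
    [p (x n) (x m)] is at most phi (x n) - q + psi (x m), hence close to [q] from
    above; it is at least the self-distance of [x n], which is close to [q]. *)
Lemma cauchy_sequence_of_distributor (q : R) (phi psi : X -> \bar R) :
  is_presheaf q%:E phi -> is_copresheaf q%:E psi ->
  ereal_inf [set dcomp (psi z) (p z z) (phi z) | z in [set: X]] <= q%:E ->
  (forall x y, p y x <= dcomp (phi y) q%:E (psi x)) ->
  exists2 x : nat -> finite_part X, cauchy_sequence x &
    forall e : R, (0 < e)%R -> \forall n \near \oo,
      dcomp (psi (sval (x n))) (p (sval (x n)) (sval (x n)))
        (phi (sval (x n))) < (q + e)%:E.
Proof.
move=> phiP psiP counit unit.
have /choice[x xP] n : exists z : finite_part X,
    dcomp (psi (sval z)) (p (sval z) (sval z)) (phi (sval z)) <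
      (q + n.+1%:R^-1)%:E.
  have /ereal_inf_lt[_ [z _ <-] lt] :
      ereal_inf [set dcomp (psi z) (p z z) (phi z) | z in [set: X]] <
        (q + n.+1%:R^-1)%:E.
    by apply: le_lt_trans counit _; rewrite lte_fin ltrDl.
  have zfin : p z z < +oo.
    by move: lt; rewrite /dcomp; case: (p z z) => [r| |] //; rewrite ?ltry.
  by exists (exist _ z zfin).
have xe (e : R) : (0 < e)%R -> \forall n \near \oo,
      dcomp (psi (sval (x n))) (p (sval (x n)) (sval (x n)))
        (phi (sval (x n))) < (q + e)%:E.
  move=> e0; near=> n; apply: lt_trans (xP n) _; rewrite lte_fin ltrD2l.
  by near: n; exact: (near_infty_natSinv_lt (PosNum e0)).
exists x => //; apply/cauchy_sequenceP => e e0.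
have [|N _ NP] := xe (e / 3)%R; first by lra.
pose y i : X := sval (x i).
have bounds i : (N <= i)%N -> exists2 r : R, p (y i) (y i) = r%:E &
    [/\ (q <= r + e / 3)%R, phi (y i) <= (q + e / 3)%:E, 0 <= phi (y i) &
      psi (y i) <= (q + e / 3)%:E].
  move=> Ni; have phy := (phiP (y i) (y i)).1; have psy := (psiP (y i) (y i)).1.
  have [r rE [_ psq phr phq]] :=
    dcomp_squeeze (gpm_dist_ge0 (y i) (y i)) psy phy (NP i Ni).
  exists r => //; move: phy; rewrite ge_max => /andP[qphi phy].
  split; [|exact: ltW|exact: le_trans (gpm_dist_ge0 _ _) phy|exact: ltW].
  by rewrite -lee_fin; exact: le_trans qphi phr.
exists N => n m k l /bounds[rn _ [_ phn phn0 _]] /bounds[rm _ [_ _ _ psm]].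
move=> /bounds[r rE [qr _ _ _]] _.
apply: le_trans (unit (y m) (y n)) _.
apply: le_trans (dcomp_le_addl phn0 psm) _.
apply: le_trans (leeD2r _ phn) _.
apply: (@le_trans _ _ (r%:E + e%:E)); first by rewrite -!EFinD lee_fin; lra.
by rewrite leeD2r // -rE; exact: (gpm_self_le (y l) (y k)).2.
Unshelve. all: by end_near. Qed.

End Representability.

Lemma cauchy_distributor_infty (R : realType) (X : gpmSpace R) :
  @is_cauchy_distributor R X +oo (fun=> +oo).
Proof.
split=> [x y|]; first by rewrite ge_max !leey dcompyr ?gpm_dist_ge0.
exists (fun=> +oo); split=> [x y||x y]; [|exact: leey|exact: leey].
by rewrite ge_max !leey dcompyl ?gpm_dist_ge0.
Qed.

Theorem corollary5p3p7 (R : realType) (X : gpmSpace R) :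
  categorically_cauchy_complete X <->
  (sequentially_cauchy_complete (finite_part X) /\
   exists x : X, gpm_dist x x = +oo%E).
Proof.
split=> [cX|[sX [w wE]] q phi q0 [phiP [psi [psiP counit unit]]]].
- split=> [x xC|].
    apply: cvg_of_limit_representable => //; apply: cX.
      by have [q -> q0] := limit_type_real xC; rewrite lee_fin.
    exact: limit_cauchy_distributor.
  have [|x [xE _]] := cX +oo (fun=> +oo) (leey _); last by exists x; rewrite -xE.
  exact: cauchy_distributor_infty.
- case: q q0 phiP psiP counit unit => [q| |] // q0 phiP psiP counit unit.
  + have [x xC xe] := cauchy_sequence_of_distributor phiP psiP counit unit.
    have [l /cvg_cat_spaceP xl] := sX x xC.
    have [e e0|qE phiE] :=
        @cauchy_distributor_represented _ _ q phi psi l phiP psiP unit.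
      near \oo => n; exists (sval (x n)); split; near: n; first exact: xe.
      exact: xl.
    by exists (sval l).
  + (* the presheaf bound q <= phi leaves no other value than +oo *)
    exists w; split=> //; apply/funext => y.
    have := (phiP y y).1; rewrite ge_max => /andP[+ _].
    have := gpm_self_le w y; rewrite wE => -[+ _].
    by rewrite !leye_eq => /eqP -> /eqP.
Unshelve. all: by end_near. Qed.
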